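(* Let $G$ be a connected, locally finite chordal graph. For every clique tree $T$ of $G$, the set $\{K_1\cap K_2 : K_1K_2 \text{ an edge of } T\}$ equals the set of minimal separators of $G$ (in particular it does not depend on $T$). Moreover, the union of all clique trees of $G$ is the reduced clique graph of $G$.
   Context: A chordal graph is a loopless graph without multiple edges with no induced cycle of length greater than $3$; chordal graphs are assumed connected; locally finite means all degrees finite. A clique is a maximal complete vertex set. The clique graph $\mathcal{C}(G)$ has the cliques as vertices and an edge between distinct cliques with non-empty intersection. A clique tree is a spanning tree $T$ of $\mathcal{C}(G)$ such that for every vertex $v$ the subgraph of $T$ induced by the cliques containing $v$ is a tree. A non-empty $W\subseteq V$ is a separator if $G[V\setminus W]$ has more than one connected component; a minimal separator is one minimal with respect to inclusion. The reduced clique graph is the subgraph of $\mathcal{C}(G)$ (on all cliques) retaining exactly those edges $K_1K_2$ for which $K_1\cap K_2$ is a minimal separator. The union of clique trees means the graph on all cliques whose edge set is the union of their edge sets.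
   Formalization: ''Minimal separator'' is read as minimal among sets separating some fixed pair of vertices, not among all separators; an edge K1K2 of the reduced clique graph needs K1∩K2 to be a minimal separator between a vertex of K1 and one of K2. The literal wording fails on small finite graphs. *)

(* Defs.v *)
From Stdlib Require Import Relations.
From mathcomp Require Import all_boot.
From mathcomp Require Import boolp classical_sets functions cardinality.

Set Implicit Arguments.
Unset Strict Implicit.
Unset Printing Implicit Defensive.

Local Open Scope classical_set_scope.

(* Simple graphs on a possibly infinite vertex type. *)
Record graph (V : Type) := Graph {
  adj :> V -> V -> Prop;
  adj_sym : forall x y, adj x y -> adj y x;
  adj_irrefl : forall x, ~ adj x x
}.

Section Graphs.
Variables (V : Type) (G : graph V).

Definition reachable : V -> V -> Prop := clos_refl_trans V G.

Definition connected_graph : Prop :=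
  inhabited V /\ forall x y : V, reachable x y.

Definition locally_finite : Prop :=
  forall x : V, finite_set [set y | G x y].

Definition induced (W : set V) : graph {x : V | W x} :=
  Graph (fun x y => @adj_sym V G (sval x) (sval y))
        (fun x => @adj_irrefl V G (sval x)).

Definition subgraph (H : graph V) : Prop := forall x y, H x y -> G x y.

(* For n >= 3 this is the adjacency relation of the cycle C_n on 'I_n. *)
Definition cyclic_adj n (i j : 'I_n) : Prop := j = ordS i \/ i = ordS j.

Definition is_cycle n (c : 'I_n -> V) : Prop :=
  [/\ (3 <= n)%N, injective c & forall i j, cyclic_adj i j -> G (c i) (c j)].

Definition is_induced_cycle n (c : 'I_n -> V) : Prop :=
  [/\ (3 <= n)%N, injective c & forall i j, cyclic_adj i j <-> G (c i) (c j)].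

Definition chordal : Prop :=
  forall n (c : 'I_n -> V), (3 < n)%N -> ~ is_induced_cycle c.

Definition is_tree : Prop :=
  connected_graph /\ forall n (c : 'I_n -> V), ~ is_cycle c.

Definition complete_set (K : set V) : Prop :=
  forall x y, K x -> K y -> x <> y -> G x y.

Definition is_clique (K : set V) : Prop :=
  complete_set K /\ forall K', complete_set K' -> K `<=` K' -> K' = K.

Definition clique := {K : set V | is_clique K}.

End Graphs.

Section Separators.
Variables (V : Type) (G : graph V).

(* W is a separator of G with u and v in different components of G - W;
   the separators of G are the sets separating some pair of vertices. *)
Definition separates (W : set V) (u v : V) : Prop :=
  W !=set0 /\
  exists (hu : (~` W) u) (hv : (~` W) v),
    ~ reachable (induced G (~` W)) (exist _ u hu) (exist _ v hv).

Definition minimal_separator_between (u v : V) (W : set V) : Prop :=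
  separates W u v /\ forall W', W' `<=` W -> separates W' u v -> W' = W.

(* Inclusion-minimality is relative to a separated pair of vertices, as usual
   for chordal graphs: a minimal separator may properly contain another one.
   For example, with cliques {a,b,x}, {a,b,y}, {a,z}, both {a} and {a,b} are
   minimal separators. *)
Definition minimal_separator (W : set V) : Prop :=
  exists u v, minimal_separator_between u v W.

Lemma separates_sym W u v : separates W u v -> separates W v u.
Proof.
move=> [W0 [hu [hv h]]]; split=> //; exists hv, hu => r; apply: h.
elim: r => [x y xy|x|x y z _ yx _ zy].
- by apply: rt_step; exact: adj_sym.
- exact: rt_refl.
- exact: rt_trans zy yx.
Qed.

Lemma minimal_separator_between_sym u v W :
  minimal_separator_between u v W -> minimal_separator_between v u W.
Proof.
move=> [s h]; split; first exact: separates_sym.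
by move=> W' W'W s'; apply: h => //; exact: separates_sym.
Qed.

End Separators.

Section CliqueTrees.
Variables (V : Type) (G : graph V).

Definition clique_adj (K1 K2 : clique G) : Prop :=
  K1 <> K2 /\ (sval K1 `&` sval K2) !=set0.

Lemma clique_adj_sym K1 K2 : clique_adj K1 K2 -> clique_adj K2 K1.
Proof. by move=> [/nesym neq ne0]; split=> //; rewrite setIC. Qed.

Lemma clique_adj_irrefl K : ~ clique_adj K K.
Proof. by move=> []. Qed.

Definition clique_graph : graph (clique G) :=
  Graph clique_adj_sym clique_adj_irrefl.

Definition is_clique_tree (T : graph (clique G)) : Prop :=
  [/\ subgraph clique_graph T, is_tree T &
      forall v : V, is_tree (induced T [set K | sval K v])].

Definition edge_intersections (T : graph (clique G)) : set (set V) :=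
  [set S | exists K1 K2, T K1 K2 /\ S = sval K1 `&` sval K2].

(* The intersection has to be a minimal separator between K1 and K2 themselves,
   that is, between vertices u of K1 \ K2 and v of K2 \ K1 (which choice of u
   and v does not matter). It is not enough that it is a minimal separator for
   some vertices elsewhere in G: with cliques {s,x,p}, {s,p,q}, {s,q,y}, {s,z},
   the cut vertex s is all that {s,x,p} and {s,q,y} share, yet it does not
   separate them and they are adjacent in no clique tree. *)
Definition reduced_adj (K1 K2 : clique G) : Prop :=
  clique_graph K1 K2 /\
  exists u v, [/\ sval K1 u, sval K2 v &
    minimal_separator_between G u v (sval K1 `&` sval K2)].

Lemma reduced_adj_sym K1 K2 : reduced_adj K1 K2 -> reduced_adj K2 K1.
Proof.
move=> [adjK [u [v [Ku Kv]]]]; rewrite setIC => sepK.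
split; first exact: adj_sym.
by exists v, u; split=> //; exact: minimal_separator_between_sym.
Qed.

Lemma reduced_adj_irrefl K : ~ reduced_adj K K.
Proof. by move=> [adjK _]; exact: adj_irrefl adjK. Qed.

Definition reduced_clique_graph : graph (clique G) :=
  Graph reduced_adj_sym reduced_adj_irrefl.

Definition union_adj (K1 K2 : clique G) : Prop :=
  exists2 T, is_clique_tree T & T K1 K2.

Lemma union_adj_sym K1 K2 : union_adj K1 K2 -> union_adj K2 K1.
Proof. by move=> [T ? ?]; exists T => //; exact: adj_sym. Qed.

Lemma union_adj_irrefl K : ~ union_adj K K.
Proof. by move=> [T _ adjK]; exact: adj_irrefl adjK. Qed.

Definition clique_tree_union : graph (clique G) :=
  Graph union_adj_sym union_adj_irrefl.

End CliqueTrees.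

(* Main.v *)
(* If AB is an edge of a clique tree T, then the intersection of A and B
   separates the two sides of T - AB, minimally since its vertices are adjacent
   to A \ B and to B \ A.
   Conversely, if W separates u from v, then on the path of T between a clique
   at u and a clique at v some edge has its intersection inside W, otherwise u
   and v would be linked outside W. Hence the edge intersections are the minimal
   separators, and an edge KL of the reduced clique graph can be exchanged for
   an edge of the path from K to L in T with the same intersection.

   A clique tree is obtained without compactness argument: for every S, the
   cliques containing S fall into classes, according to the component of G - S
   in which they lie, and a star joins representatives of all the classes. The
   union of these stars is a clique tree. It is connected on the cliques
   containing S by induction on decreasing #|S|: by chordality, all vertices of
   a geodesic of G - S between common neighbours of S are common neighbours of
   S, so that two cliques in the same class are joined by a chain of cliques
   whose consecutive intersections properly contain S. It has no cycle, because
   an edge of least intersection S on a cycle would change the class with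
   respect to S of a representative, and no other edge of the cycle does. *)
Require Import Defs.
From Stdlib Require Import Relations.
From mathcomp Require Import all_boot finmap zify.
From mathcomp Require Import boolp classical_sets functions cardinality.

Set Implicit Arguments.
Unset Strict Implicit.
Unset Printing Implicit Defensive.

Local Open Scope classical_set_scope.

Notation reach := (clos_refl_trans _).

(** * Walks, geodesics and edge removal in a relation *)

Section Reachability.
Variable X : Type.
Implicit Types (R : X -> X -> Prop) (W : set X) (x y a b : X).

Definition restrict R W x y := [/\ R x y, W x & W y].

Definition remove_edge R a b x y :=
  [/\ R x y, ~ (x = a /\ y = b) & ~ (x = b /\ y = a)].

Lemma reach_sym R x y :
  (forall u v, R u v -> R v u) -> reach R x y -> reach R y x.
Proof.
move=> symR; elim=> [u v /symR|u|u v w _ vu _ wv]; first exact: rt_step.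
- exact: rt_refl.
- exact: rt_trans wv vu.
Qed.

Lemma reach_mono R R' x y :
  (forall u v, R u v -> reach R' u v) -> reach R x y -> reach R' x y.
Proof.
move=> RR'; elim=> [u v /RR'//|u|u v w _ uv _ vw]; first exact: rt_refl.
exact: rt_trans uv vw.
Qed.

Lemma reach_sub R R' x y :
  (forall u v, R u v -> R' u v) -> reach R x y -> reach R' x y.
Proof. by move=> RR'; apply: reach_mono => u v /RR'; exact: rt_step. Qed.

Lemma reach_invariant R (P : X -> Prop) x y :
  (forall u v, R u v -> P u -> P v) -> reach R x y -> P x -> P y.
Proof. by move=> RP; elim=> [u v /RP//|//|u v w _ uv _ vw /uv/vw]. Qed.

Lemma restrict_sym R W :
  (forall u v, R u v -> R v u) ->
  forall u v, restrict R W u v -> restrict R W v u.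
Proof. by move=> symR u v [/symR]. Qed.

Lemma remove_edge_sym R a b :
  (forall u v, R u v -> R v u) ->
  forall u v, remove_edge R a b u v -> remove_edge R a b v u.
Proof. by move=> symR u v [/symR Rvu nab nba]; split=> // -[]; tauto. Qed.

Lemma remove_edgeC R a b x y : remove_edge R a b x y -> remove_edge R b a x y.
Proof. by case. Qed.

(** Tracks the last use of [a b]: a walk with one extra edge either never uses it, or its ends reach
    the ends of that edge in [R]. *)
Lemma reach_add_edge R R' a b x y :
  (forall u v, R' u v -> [\/ R u v, u = a /\ v = b | u = b /\ v = a]) ->
  reach R' x y ->
  [\/ reach R x y, reach R x a /\ reach R b y | reach R x b /\ reach R a y].
Proof.
move=> R'R xy; elim: (clos_rt_rtn1 _ _ _ _ xy) => [|u v /R'R uv _].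
  by apply: Or31; exact: rt_refl.
case: uv => [Ruv|[-> ->]|[-> ->]] [xu|[xa bu]|[xb au]].
- by apply: Or31; exact: rt_trans (rt_step _ _ _ _ Ruv).
- by apply: Or32; split=> //; exact: rt_trans (rt_step _ _ _ _ Ruv).
- by apply: Or33; split=> //; exact: rt_trans (rt_step _ _ _ _ Ruv).
- by apply: Or32; split=> //; exact: rt_refl.
- by apply: Or32; split=> //; exact: rt_refl.
- by apply: Or31.
- by apply: Or33; split=> //; exact: rt_refl.
- by apply: Or31.
- by apply: Or33; split=> //; exact: rt_refl.
Qed.

Definition walk R m (p : nat -> X) x y :=
  [/\ p 0 = x, p m = y & forall k, (k < m)%N -> R (p k) (p k.+1)].

Lemma walk_cat R m n p q x y z :
  walk R m p x y -> walk R n q y z -> exists r, walk R (m + n) r x z.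
Proof.
move=> [p0 pm pR] [q0 qn qR].
exists (fun k => if (k <= m)%N then p k else q (k - m)%N); split.
- by rewrite leq0n.
- rewrite addKn -{2}(addn0 m) leq_add2l.
  by case: (n) qn => [<-|] //=; rewrite addn0 q0.
- move=> k; case: (ltngtP k m) => [km _|mk kmn|->].
  + exact: pR.
  + rewrite subSn ?(ltnW mk) //; apply: qR.
    by rewrite ltn_subLR ?(ltnW mk).
  + rewrite subSnn pm -q0 -{1}(addn0 m) ltn_add2l; exact: qR.
Qed.

Lemma sub_walk R m p x y i j :
  walk R m p x y -> (i <= j)%N -> (j <= m)%N ->
  walk R (j - i) (fun k => p (i + k)%N) (p i) (p j).
Proof.
move=> [_ _ pR] ij jm; split; first by rewrite addn0.
- by rewrite subnKC.
- move=> k kji; rewrite addnS; apply: pR; apply: leq_trans jm.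
  by rewrite -ltn_subRL.
Qed.

Lemma walk_reach R m p x y : walk R m p x y -> reach R x y.
Proof.
elim: m x y => [|m IHm] x y [<- <- pR]; first exact: rt_refl.
apply: rt_trans (rt_step _ _ _ _ (pR m (ltnSn m))).
by apply: IHm; split=> // k km; apply: pR; rewrite ltnW.
Qed.

Lemma reach_walk R x y : reach R x y -> exists m p, walk R m p x y.
Proof.
elim=> [u v uv|u|u v w _ [m [p up]] _ [n [q vq]]].
- by exists 1, (fun k => if k is 0 then u else v); split=> // -[].
- by exists 0, (fun _ => u); split.
- by have [r] := walk_cat up vq; exists (m + n)%N, r.
Qed.

(** Being shortest enters only through two consequences: no vertex is repeated and there is no
    chord. *)
Definition geodesic R m (p : nat -> X) x y :=
  [/\ walk R m p x y,
      forall i j, (i <= m)%N -> (j <= m)%N -> p i = p j -> i = j &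
      forall i j, (i < j <= m)%N -> R (p i) (p j) -> j = i.+1].

(** A walk of least length will do: a repeated vertex is a shortcut of length 0, a chord a shortcut
    of length 1. *)
Lemma geodesic_exists R x y : reach R x y -> exists m p, geodesic R m p x y.
Proof.
move=> xy.
have ex : exists m, `[< exists p, walk R m p x y >].
  by have [m [p w]] := reach_walk xy; exists m; apply/asboolP; exists p.
have [m /asboolP[p w] m_min] := ex_minnP ex; exists m, p.
have [p0 pm _] := w.
have shortcut i j d q :
    (i <= j <= m)%N -> walk R d q (p i) (p j) -> (j - i <= d)%N.
  move=> /andP[ij jm] wq.
  have wi := sub_walk w (leq0n i) (leq_trans ij jm).
  have wj := sub_walk w jm (leqnn m).
  have [r wr] := walk_cat wi wq; have [r' wr'] := walk_cat wr wj.
  rewrite p0 pm in wr'.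
  have : (m <= i - 0 + d + (m - j))%N by apply: m_min; apply/asboolP; exists r'.
  rewrite subn0 -{1}(subnKC jm) leq_add2r => jid.
  by rewrite leq_subLR.
split=> //.
- suff inj i j : (i <= j)%N -> (j <= m)%N -> p i = p j -> i = j.
    move=> i j im jm pij; case: (leqP i j) => [ij|/ltnW ji].
      exact: inj.
    by apply/esym/inj.
  move=> ij jm pij; apply/eqP; rewrite eqn_leq ij -subn_eq0 -leqn0.
  by apply: (shortcut i j 0 (fun=> p i)); [rewrite ij|split].
- move=> i j /andP[ij jm] Rij; apply/eqP; rewrite eqn_leq ij andbT.
  rewrite -addn1 -leq_subLR.
  apply: (shortcut i j 1 (fun k => if k is 0 then p i else p j)).
    by rewrite ltnW.
  by split=> // -[].
Qed.

(** Takes the first edge outside [Q] on a geodesic. The edges before it lie in [Q], hence differ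
    from it; the edges after it do not return to its first vertex. *)
Lemma find_edge R Q x y :
  (forall u v, Q u v -> Q v u) -> (forall u v, Q u v -> R u v) ->
  reach R x y -> ~ reach Q x y ->
  exists a b, [/\ R a b, ~ Q a b, reach (remove_edge R a b) x a &
                  reach (remove_edge R a b) b y].
Proof.
move=> symQ QR /geodesic_exists[m [p [w inj _]]].
elim: m p x y w inj => [|m IHm] p x y [<- <- pR] inj nQ.
  by case: nQ; exact: rt_refl.
have [Q01|nQ01] := pselect (Q (p 0) (p 1)); last first.
  exists (p 0), (p 1); split=> //; first exact: pR.
    exact: rt_refl.
  apply: (@walk_reach _ m (fun k => p k.+1)); split=> // k km.
  split; first exact: pR.
    by move=> [/inj]; rewrite !ltnS (ltnW km) => /(_ isT isT).
  by move=> [_ /inj]; rewrite !ltnS km => /(_ isT isT).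
have [||q1|] := IHm (fun k => p k.+1) (p 1) (p m.+1).
- by split=> // k km; apply: pR.
- by move=> i j im jm /(inj i.+1 j.+1 im jm)[].
- by apply: nQ; apply: rt_trans q1; exact: rt_step.
move=> a [b [Rab nQab xa yb]]; exists a, b; split=> //.
apply: rt_trans xa; apply: rt_step; split; first exact: QR.
- by move=> [e0 e1]; apply: nQab; rewrite -e0 -e1.
- by move=> [e0 e1]; apply: nQab; apply: symQ; rewrite -e0 -e1.
Qed.

End Reachability.

Lemma sval_inj (T : Type) (P : T -> Prop) : injective (@sval T P).
Proof.
by move=> [x Px] [y Py] /= e; subst y; rewrite (Prop_irrelevance Px Py).
Qed.

(** * Induced subgraphs, cycles, bridges and trees *)

Section Graphs.
Variables (X : Type) (G : graph X).

Lemma reachable_inducedP (W : set X) u v (hu : W u) (hv : W v) :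
  reachable (induced G W) (exist _ u hu) (exist _ v hv) <->
  reach (restrict G W) u v.
Proof.
split=> [uv|uv].
  suff: forall x y, reachable (induced G W) x y ->
      reach (restrict G W) (sval x) (sval y) by move/(_ _ _ uv).
  move=> x y; elim=> [[a ha] [b hb] ab|a|a b d _ ab _ bd].
  - exact: rt_step.
  - exact: rt_refl.
  - exact: rt_trans ab bd.
(* The membership proof [hv] is generalised, because the induction changes the end of the walk. *)
elim: (clos_rt_rtn1 _ _ _ _ uv) hv => [hu'|a b [ab Wa Wb] _ IH hv].
  by rewrite (Prop_irrelevance hu hu'); exact: rt_refl.
exact: rt_trans (IH Wa) (rt_step _ _ _ _ _).
Qed.

Lemma iter_ordS n (i : 'I_n) k : val (iter k (@ordS n) i) = ((i + k) %% n)%N.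
Proof.
elim: k => [|k IHk] /=; first by rewrite addn0 modn_small.
by rewrite IHk -addn1 modnDml addn1 addnS.
Qed.

Lemma iter_ordS_neq n (i : 'I_n) k : (0 < k < n)%N -> iter k (@ordS n) i <> i.
Proof.
move=> /andP[k0 kn] /(congr1 val)/eqP; rewrite iter_ordS.
rewrite -[X in _ == X](modn_small (ltn_ord i)) -[X in _ == X %[mod n]]addn0.
rewrite eqn_modDl mod0n modn_small //.
by rewrite eqn0Ngt k0.
Qed.

(** The remaining [n.-1] edges go round the cycle the other way; writing [i] as its own [n]-th
    iterate under [ordS] turns this into an induction on the number of steps. *)
Lemma cycle_detour n (c : 'I_n -> X) i : is_cycle G c ->
  reach (fun x y => exists2 j, j <> i & x = c j /\ y = c (ordS j))
    (c (ordS i)) (c i).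
Proof.
move=> [n3 _ _].
have n0 : (0 < n)%N by exact: leq_trans n3.
have -> : c i = c (iter n.-1.+1 (@ordS n) i).
  congr c; apply: val_inj; rewrite iter_ordS (prednK n0) modnDr.
  by rewrite modn_small.
have : (n.-1 < n)%N by rewrite (prednK n0).
elim: n.-1 => [|k IHk] kn; first exact: rt_refl.
apply: rt_trans (IHk (ltnW kn)) _; apply: rt_step.
by exists (iter k.+1 (@ordS n) i) => //; exact: iter_ordS_neq.
Qed.

(** A reversed coincidence would give [ordS (ordS i) = i], which is impossible for [n] at least
    3. *)
Lemma cycle_edge_inj n (c : 'I_n -> X) i j : is_cycle G c -> j <> i ->
  ~ (c j = c i /\ c (ordS j) = c (ordS i)) /\
  ~ (c j = c (ordS i) /\ c (ordS j) = c i).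
Proof.
move=> [n3 inj _] ji; split=> -[/inj ej /inj eSj]; first exact: ji.
move: eSj; rewrite ej; exact: (@iter_ordS_neq _ _ 2).
Qed.

Lemma bridges_acyclic :
  (forall a b, G a b -> ~ reach (remove_edge G a b) a b) ->
  forall n (c : 'I_n -> X), ~ is_cycle G c.
Proof.
move=> bridge n c cyc; have [n3 inj Gc] := cyc.
pose i := Ordinal (leq_trans (isT : (0 < 3)%N) n3).
have Gi : G (c (ordS i)) (c i) by apply: Gc; right.
apply: bridge Gi _; apply: reach_sub (cycle_detour i cyc).
move=> u v [j ji [-> ->]]; have [e1 e2] := cycle_edge_inj cyc ji.
by split=> //; apply: Gc; left.
Qed.

(** A geodesic from [a] to [b] avoiding the edge [a b] has length at least 2, so that edge closes it
    to a cycle. *)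
Lemma tree_bridge a b :
  is_tree G -> G a b -> ~ reach (remove_edge G a b) a b.
Proof.
move=> [_ acyc] Gab ab.
have [m [p [[p0 pm pR] inj _]]] := geodesic_exists ab.
have m2 : (2 <= m)%N.
  case: m pm pR {inj} => [|[|m]] pm pR //.
    by case: (adj_irrefl (g := G) (x := a)); rewrite -{2}p0 pm.
  by have [_ []] := pR 0 isT; rewrite p0 pm.
apply: (acyc m.+1 (fun i => p i)); split=> //.
  by move=> i j eij; apply: val_inj; apply: inj => //; rewrite -ltnS ltn_ord.
suff adjS (i : 'I_m.+1) : G (p i) (p (ordS i)).
  by move=> i j [->|->] //; exact: adj_sym.
rewrite /=; have := ltn_ord i; rewrite ltnS leq_eqVlt => /orP[/eqP->|im].
  by rewrite modnn p0 pm; exact: adj_sym.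
by rewrite modn_small //; have [] := pR i im.
Qed.

(** Acyclicity passes to induced subgraphs, so only non-emptiness and connectedness remain. *)
Lemma induced_treeP W : is_tree G ->
  is_tree (induced G W) <->
  W !=set0 /\ forall x y, W x -> W y -> reach (restrict G W) x y.
Proof.
move=> [_ acyc]; split=> [[[[[x Wx]] conn] _]|[[x Wx] conn]].
  split=> [|u v Wu Wv]; first by exists x.
  by apply/(reachable_inducedP Wu Wv).
split; first split.
- by constructor; exists x.
- by move=> [u Wu] [v Wv]; apply/reachable_inducedP/conn.
- move=> n c [n3 inj adjc]; apply: (acyc n (fun i => sval (c i))); split=> //.
  by move=> i j eij; exact/inj/sval_inj.
Qed.

End Graphs.

(** * Cliques and separators in a locally finite graph *)

Section Cliques.
Variables (V : Type) (G : graph V).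
Hypothesis lfG : locally_finite G.
Implicit Types (S W : set V) (K L : clique G) (u v : V).

(* Cardinality of a finite set; junk value 0 on infinite sets. *)
Definition fcard S : nat := #|` fset_set (S : set {classic V}) |%fset.

Lemma fcard_sub S W : finite_set W -> S `<=` W -> (fcard S <= fcard W)%N.
Proof.
move=> finW sub; apply: fsubset_leq_card; rewrite -fset_set_sub //.
exact: sub_finite_set finW.
Qed.

Lemma fcard_proper S W : finite_set W -> S `<` W -> (fcard S < fcard W)%N.
Proof.
move=> finW; rewrite properEneq => -[/eqP neq sub].
have finS := sub_finite_set sub finW.
apply: fproper_ltn_card; rewrite fproperEneq.
have -> : (fset_set (S : set {classic V}) `<=`
           fset_set (W : set {classic V}))%fset.
  by rewrite -fset_set_sub.
rewrite andbT; apply/eqP => /fset_set_inj eqSW.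
exact/neq/eqSW.
Qed.

Definition closed_nbhd v := [set w | w = v \/ G v w].

Lemma finite_closed_nbhd v : finite_set (closed_nbhd v).
Proof.
have -> : closed_nbhd v = [set v] `|` [set w | G v w] by [].
by rewrite finite_setU; split; [exact: finite_set1|exact: lfG].
Qed.

Lemma complete_closed_nbhd S v :
  complete_set G S -> S v -> S `<=` closed_nbhd v.
Proof.
move=> complS Sv w Sw; have [->|wv] := pselect (w = v); first by left.
by right; apply: complS => // /esym.
Qed.

Lemma finite_complete S v : complete_set G S -> S v -> finite_set S.
Proof.
move=> complS Sv.
exact: sub_finite_set (complete_closed_nbhd complS Sv) (finite_closed_nbhd v).
Qed.

Lemma clique_complete K : complete_set G (sval K).
Proof. by case: K => K []. Qed.

Lemma clique_eq K L : sval K `<=` sval L -> K = L.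
Proof.
move=> KL; apply: sval_inj; apply/esym.
by case: K KL => K [_ maxK] /=; apply: maxK; exact: clique_complete.
Qed.

Lemma clique_diff K L : K <> L -> exists2 u, sval K u & ~ sval L u.
Proof.
move=> KL; apply: contrapT => noU; apply: KL; apply: clique_eq => u Ku.
by apply: contrapT => nLu; apply: noU; exists u.
Qed.

(** Every complete set containing [v] lies in the finite closed neighbourhood of [v], so enlarging
    [S] must stop. *)
Lemma complete_sub_clique S v : complete_set G S -> S v ->
  exists K, S `<=` sval K.
Proof.
have [n] := ubnP (fcard (closed_nbhd v) - fcard S).
elim: n S => // n IHn S lt_n complS Sv.
have [maxS|] := pselect (is_clique G S); first by exists (exist _ S maxS).
move=> /not_andP[//|] /existsNP[S' /not_implyP[complS' /not_implyP[SS' neq]]].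
have S'v := SS' _ Sv.
have ltS : (fcard S < fcard S')%N.
  apply: fcard_proper; first exact: finite_complete S'v.
  by rewrite properEneq; split=> //; apply/eqP => /esym.
have leS' : (fcard S' <= fcard (closed_nbhd v))%N.
  exact: fcard_sub (finite_closed_nbhd v) (complete_closed_nbhd complS' S'v).
have [|//|//|K S'K] := IHn S'; last by exists K; exact: subset_trans S'K.
apply: leq_trans (lt_n : (_ <= n)%N); apply: ltn_sub2l => //.
exact: leq_trans leS'.
Qed.

Lemma vertex_in_clique v : exists K, sval K v.
Proof.
have [||K vK] := @complete_sub_clique [set v] v; last by exists K; exact: vK.
  by move=> x y -> ->.
by [].
Qed.

Lemma edge_in_clique u v : G u v -> exists K, sval K u /\ sval K v.
Proof.
move=> uv; have [||K uvK] := @complete_sub_clique [set u; v] u.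
- by move=> x y [->|->] [->|->] //; move=> _; exact: adj_sym.
- by left.
- by exists K; split; apply: uvK; [left|right].
Qed.

Definition linked S u v := reach (restrict G (~` S)) u v.

Lemma linked_sym S u v : linked S u v -> linked S v u.
Proof. by apply: reach_sym; apply: restrict_sym; exact: adj_sym. Qed.

Lemma clique_linked S K u v :
  sval K u -> sval K v -> ~ S u -> ~ S v -> linked S u v.
Proof.
move=> Ku Kv nSu nSv; have [->|uv] := pselect (u = v); first exact: rt_refl.
by apply: rt_step; split=> //; exact: (clique_complete (K := K)).
Qed.

Lemma separatesP S u v :
  separates G S u v <-> [/\ S !=set0, ~ S u, ~ S v & ~ linked S u v].
Proof.
split=> [[S0 [hu [hv nuv]]]|[S0 hu hv nuv]].
  by split=> // uv; apply: nuv; apply/reachable_inducedP.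
by split=> //; exists hu, hv => /reachable_inducedP.
Qed.

(** A vertex [s] of the intersection lies in a clique with [u] and in one with [v]; a smaller set
    missing [s] leaves [u] and [v] linked through [s]. *)
Lemma minimal_separator_clique_edge K L u v :
  separates G (sval K `&` sval L) u v -> sval K u -> sval L v ->
  minimal_separator_between G u v (sval K `&` sval L).
Proof.
move=> sepS Ku Lv; split=> // W WS /separatesP[W0 nWu nWv nuv].
apply/seteqP; split=> // s [Ks Ls]; apply: contrapT => nWs; apply: nuv.
apply: (@rt_trans _ _ u s); first exact: clique_linked Ks nWu nWs.
exact: clique_linked Lv nWs nWv.
Qed.

(** * Edges of a clique tree and minimal separators *)

Section CliqueTree.
Variable T : graph (clique G).
Hypothesis treeT : is_clique_tree T.

Lemma clique_tree_reach v K L : sval K v -> sval L v ->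
  reach (restrict T [set M | sval M v]) K L.
Proof.
case: treeT => _ tT /(_ v)/(induced_treeP _ tT)[_ conn] Kv Lv.
exact: conn.
Qed.

Lemma clique_tree_bridge K L : T K L -> ~ reach (remove_edge T K L) K L.
Proof. by case: treeT => _ tT _; exact: tree_bridge. Qed.

Lemma clique_tree_edge_neq K L : T K L -> K <> L.
Proof. by case: treeT => + _ _ => /(_ K L) sub /sub[]. Qed.

(** The cliques containing a vertex outside the intersection of [A] and [B] are connected without
    the edge [A B], so they all lie on one side of it. *)
Lemma clique_tree_edge_separates A B K L u v :
  T A B -> reach (remove_edge T A B) K A -> reach (remove_edge T A B) B L ->
  sval K u -> sval L v ->
  ~ (sval A `&` sval B) u -> ~ (sval A `&` sval B) v ->
  separates G (sval A `&` sval B) u v.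
Proof.
move=> TAB KA BL Ku Lv nu nv.
have avoidAB w M N : ~ (sval A `&` sval B) w -> sval M w -> sval N w ->
    reach (remove_edge T A B) M N.
  move=> nw Mw Nw.
  apply: reach_sub (clique_tree_reach Mw Nw) => x y [Txy xw yw].
  by split=> // -[ex ey]; apply: nw; rewrite -ex -ey.
apply/separatesP; split=> //.
  by case: treeT => + _ _ => /(_ _ _ TAB)[].
(* Lying in a clique on the side of [A] is preserved along edges of [G] outside the intersection; at
   [v] it would contradict that [A B] is a bridge. *)
pose side w := exists2 M, sval M w & reach (remove_edge T A B) M A.
move=> uv; have : side v.
  apply: (@reach_invariant _ _ side u v _ uv); last by exists K.
  move=> x y [xy nx _] [M Mx MA]; have [N [Nx Ny]] := edge_in_clique xy.
  by exists N => //; apply: rt_trans MA; exact: avoidAB Nx Mx.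
move=> [M Mv MA]; apply: clique_tree_bridge TAB _.
have symR := remove_edge_sym (a := A) (b := B) (@adj_sym _ T).
apply: rt_trans (reach_sym symR MA) _.
by apply: rt_trans (avoidAB _ _ _ nv Mv Lv) _; exact: reach_sym BL.
Qed.

Lemma clique_tree_edge_reduced K L : T K L -> reduced_adj K L.
Proof.
move=> TKL; have KL := clique_tree_edge_neq TKL; split.
  by case: treeT => + _ _; exact.
have [u Ku nLu] := clique_diff KL; have [v Lv nKv] := clique_diff (nesym KL).
exists u, v; split=> //; apply: minimal_separator_clique_edge => //.
by apply: clique_tree_edge_separates Ku Lv _ _ => //; try exact: rt_refl; case.
Qed.

(** The two reachability clauses place [A B] on the tree path from [K] to [L], as the exchange
    requires. *)
Lemma minimal_separator_clique_tree_edge W K L u v :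
  minimal_separator_between G u v W -> sval K u -> sval L v ->
  exists A B, [/\ T A B, W = sval A `&` sval B,
    reach (remove_edge T A B) K A & reach (remove_edge T A B) B L].
Proof.
move=> [/separatesP[W0 nWu nWv nuv] minW] Ku Lv.
(* Cliques joined by a [Q] edge share a vertex outside [W], so a [Q]-walk from [K] to [L] would link
   [u] to [v] outside [W]. *)
pose Q M N := T M N /\ ~ sval M `&` sval N `<=` W.
have linkQ M N : reach Q M N -> forall x y,
    sval M x -> ~ W x -> sval N y -> ~ W y -> linked W x y.
  move=> MN; elim: (clos_rt_rt1n _ _ _ _ MN) =>
    [P|P P' P'' [_ nW] _ IH] x y Px Wx Py Wy.
    exact: clique_linked Px Py Wx Wy.
  have [z [[Pz P'z] Wz]] : exists z, (sval P `&` sval P') z /\ ~ W z.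
    apply: contrapT => noz; apply: nW => z Pz; apply: contrapT => Wz.
    by apply: noz; exists z.
  by apply: rt_trans (IH z y _ _ _ _) => //; exact: clique_linked Px Pz Wx Wz.
have [||||A [B [TAB nQ KA BL]]] := @find_edge _ T Q K L.
- by move=> M N [TMN]; rewrite setIC => nW; split=> //; exact: adj_sym.
- by move=> M N [].
- by case: treeT => _ [[_ connT] _] _; exact: connT.
- by move=> KL; apply: nuv; exact: linkQ KL _ _ Ku nWu Lv nWv.
have ABW : sval A `&` sval B `<=` W by apply: contrapT => nABW; exact: nQ.
exists A, B; split=> //; apply/esym/minW => //.
by apply: clique_tree_edge_separates Ku Lv _ _ => // /ABW.
Qed.

Lemma edge_intersections_clique_tree :
  edge_intersections T = [set W | minimal_separator G W].
Proof.
apply/seteqP; split=> [_ [K [L [TKL ->]]]|W].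
  by have [_ [u [v [_ _ sep]]]] := clique_tree_edge_reduced TKL; exists u, v.
move=> [u [v sep]].
have [K Ku] := vertex_in_clique u; have [L Lv] := vertex_in_clique v.
have [A [B [TAB -> _ _]]] := minimal_separator_clique_tree_edge sep Ku Lv.
by exists A, B.
Qed.

End CliqueTree.
End Cliques.

(** * Exchanging an edge of a tree *)

Section Exchange.
Variables (X : Type) (T : graph X) (a b p q : X).
Hypotheses (treeT : is_tree T) (Tab : T a b) (pq : p <> q).
Hypotheses (pa : reach (remove_edge T a b) p a)
           (bq : reach (remove_edge T a b) b q).

Definition exchange_adj x y :=
  [\/ remove_edge T a b x y, x = p /\ y = q | x = q /\ y = p].

Lemma exchange_adj_sym x y : exchange_adj x y -> exchange_adj y x.
Proof.
case=> [Txy|[xp yq]|[xq yp]]; [apply: Or31|exact: Or33|exact: Or32].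
by apply: remove_edge_sym Txy; exact: adj_sym.
Qed.

Lemma exchange_adj_irrefl x : ~ exchange_adj x x.
Proof.
by case=> [[Txx]|[xp xq]|[xq xp]]; [case: (adj_irrefl Txx)|..];
  apply: pq; rewrite -xp -xq.
Qed.

Definition exchange := Graph exchange_adj_sym exchange_adj_irrefl.

Let rem_sym := remove_edge_sym (a := a) (b := b) (@adj_sym _ T).

(** A walk inside [W] that really needed the edge [a b] would have its ends on different sides of
    this bridge. *)
Lemma reach_restrict_remove W x y :
  reach (restrict T W) x y -> reach (remove_edge T a b) x y ->
  reach (restrict (remove_edge T a b) W) x y.
Proof.
move=> xyW xy.
have sub u v : reach (restrict (remove_edge T a b) W) u v ->
    reach (remove_edge T a b) u v by apply: reach_sub => ? ? [].
have split_T u v : restrict T W u v ->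
    [\/ restrict (remove_edge T a b) W u v, u = a /\ v = b | u = b /\ v = a].
  move=> [Tuv Wu Wv].
  have [uvab|nuvab] := pselect (u = a /\ v = b); first exact: Or32.
  have [uvba|nuvba] := pselect (u = b /\ v = a); first exact: Or33.
  exact: Or31.
have [//|[/sub xa /sub yb]|[/sub xb /sub ay]] := reach_add_edge split_T xyW.
- case: (tree_bridge treeT Tab); apply: rt_trans (reach_sym rem_sym xa) _.
  exact: rt_trans xy (reach_sym rem_sym yb).
- case: (tree_bridge treeT Tab); apply: rt_trans ay _.
  exact: rt_trans (reach_sym rem_sym xy) xb.
Qed.

(** The lost edge is replaced by the detour from [a] to [p], across the new edge to [q], and on to
    [b]; the hypothesis keeps this detour inside [W]. *)
Lemma exchange_reach W x y :
  (W a -> W b -> [/\ W p, W q, reach (restrict T W) p a &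
                     reach (restrict T W) b q]) ->
  reach (restrict T W) x y -> reach (restrict exchange W) x y.
Proof.
move=> Wab; apply: reach_mono => u v [Tuv Wu Wv].
have ab : W a -> W b -> reach (restrict exchange W) a b.
  move=> Wa Wb; have [Wp Wq paW bqW] := Wab Wa Wb.
  have sub w z : reach (restrict T W) w z -> reach (remove_edge T a b) w z ->
      reach (restrict exchange W) w z.
    move=> wz /(reach_restrict_remove wz); apply: reach_sub => s t [st Ws Wt].
    by split=> //; exact: Or31.
  have sym := restrict_sym (W := W) (@adj_sym _ exchange).
  apply: rt_trans (reach_sym sym (sub _ _ paW pa)) _.
  apply: rt_trans (reach_sym sym (sub _ _ bqW bq)).
  by apply: rt_step; split=> //; apply: Or32.
have [[ua vb]|nuvab] := pselect (u = a /\ v = b).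
  by rewrite ua vb in Wu Wv *; exact: ab.
have [[ub va]|nuvba] := pselect (u = b /\ v = a).
  rewrite ub va in Wu Wv *.
  by apply: reach_sym (ab Wv Wu); apply: restrict_sym; exact: adj_sym.
by apply: rt_step; split=> //; exact: Or31.
Qed.

Lemma exchange_tree : is_tree exchange.
Proof.
have [[X0 connT] _] := treeT.
have restrictT (R : X -> X -> Prop) x y :
    reach (restrict R setT) x y <-> reach R x y.
  by split; apply: reach_sub => // u v [].
split; first split=> // x y.
  apply/restrictT/exchange_reach; last by apply/restrictT; exact: connT.
  by move=> _ _; split=> //; apply/restrictT; exact: connT.
have nab := tree_bridge treeT Tab.
(* A surviving edge cannot join the side of [p] to the side of [q], since these are the sides of [a]
   and [b]. *)
have nbr x y : remove_edge T a b x y -> reach (remove_edge T a b) x p ->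
    reach (remove_edge T a b) q y -> False.
  move=> Rxy xp qy; apply: nab.
  apply: rt_trans (reach_sym rem_sym (rt_trans _ _ _ _ _ xp pa)) _.
  apply: rt_trans (rt_step _ _ _ _ Rxy) _.
  exact: (reach_sym rem_sym (rt_trans _ _ _ _ _ bq qy)).
(* Every edge is a bridge: a detour around a surviving edge either stays in [T] or uses the new edge
   and contradicts [nbr]; a detour around the new edge would join [a] to [b]. *)
apply: bridges_acyclic => x y Exy xy.
case: (Exy) => [Rxy|[ex ey]|[ex ey]].
- have split_E u v : remove_edge exchange x y u v ->
      [\/ remove_edge (remove_edge T a b) x y u v, u = p /\ v = q |
          u = q /\ v = p].
    by case=> -[uv|uv|uv] n1 n2; [apply: Or31|exact: Or32|exact: Or33].
  have sub w z : reach (remove_edge (remove_edge T a b) x y) w z ->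
      reach (remove_edge T a b) w z by apply: reach_sub => ? ? [].
  have [xyR|[/sub xp /sub qy]|[/sub xq /sub py]] := reach_add_edge split_E xy.
  + case: (tree_bridge treeT (a := x) (b := y)); first by case: Rxy.
    by apply: reach_sub xyR => u v [[]].
  + exact: nbr Rxy xp qy.
  + exact: nbr (rem_sym Rxy) (reach_sym rem_sym py) (reach_sym rem_sym xq).
- rewrite ex ey in xy; apply: nab; apply: rt_trans (reach_sym rem_sym pa) _.
  apply: rt_trans _ (reach_sym rem_sym bq); apply: reach_sub xy => u v.
  by case=> -[].
- rewrite ex ey in xy; apply: nab; apply: rt_trans (reach_sym rem_sym pa) _.
  apply: rt_trans _ (reach_sym rem_sym bq); apply: reach_sym => //.
  by apply: reach_sub xy => u v; case=> -[].
Qed.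

End Exchange.

(** Because the intersections agree, a vertex common to [A] and [B] is also in [K] and [L], so the
    detour can be chosen among the cliques containing it. *)
Lemma clique_tree_exchange (V : Type) (G : graph V) (T : graph (clique G))
    (A B K L : clique G) :
  is_clique_tree T -> T A B -> K <> L ->
  reach (remove_edge T A B) K A -> reach (remove_edge T A B) B L ->
  sval K `&` sval L = sval A `&` sval B ->
  union_adj K L.
Proof.
move=> treeT TAB KL KA BL eqI; have [subT tT vT] := treeT.
exists (exchange T A B KL); last by apply: Or32.
have tE := exchange_tree tT TAB KL KA BL.
split=> // [M N|v].
  move=> [[/subT//]|[-> ->]|[-> ->]].
    by split=> //; rewrite eqI; have [] := subT _ _ TAB.
  by split; [exact: nesym|rewrite setIC eqI; have [] := subT _ _ TAB].
apply/(induced_treeP _ tE); have /(induced_treeP _ tT)[v0 _] := vT v.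
split=> // M N Mv Nv; apply: exchange_reach; last exact: clique_tree_reach.
- exact: tT.
- exact: TAB.
- exact: KA.
- exact: BL.
move=> Av Bv; have [Kv Lv] : (sval K `&` sval L) v by rewrite eqI.
by split=> //; exact: clique_tree_reach.
Qed.

(** * Chordality: a vertex adjacent to both ends of an induced path *)

Lemma cyclic_adj_val n (i j : 'I_n) : cyclic_adj i j <->
  j = i.+1 :> nat \/ i = j.+1 :> nat \/
  (i = 0 :> nat /\ j = n.-1 :> nat) \/ (j = 0 :> nat /\ i = n.-1 :> nat).
Proof.
have valS (k : 'I_n) : val (ordS k) = if (k.+1 < n)%N then k.+1 else 0.
  rewrite /=; have := ltn_ord k; rewrite leq_eqVlt => /orP[/eqP ->|kn].
    by rewrite modnn ltnn.
  by rewrite kn modn_small.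
have eqS (k l : 'I_n) :
    l = ordS k <-> l = (if (k.+1 < n)%N then k.+1 else 0) :> nat.
  by rewrite -valS; split=> [->|/val_inj].
have := ltn_ord i; have := ltn_ord j.
by rewrite /cyclic_adj !eqS; case: ifP => ?; case: ifP => ?; lia.
Qed.

Section Fan.
Variables (V : Type) (G : graph V) (p : nat -> V) (m : nat) (s : V).
Hypothesis chordalG : chordal G.
Hypothesis inj_p : forall i j, (i <= m)%N -> (j <= m)%N -> p i = p j -> i = j.
Hypothesis adj_p : forall k, (k < m)%N -> G (p k) (p k.+1).
Hypothesis ind_p : forall i j, (i < j <= m)%N -> G (p i) (p j) -> j = i.+1.
Hypothesis p_neq : forall k, (k <= m)%N -> p k <> s.

(* Without such a k, s and p i, ..., p j would be an induced cycle. *)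
Lemma fan_gap i j : (i.+1 < j <= m)%N -> G s (p i) -> G s (p j) ->
  exists2 k, (i < k < j)%N & G s (p k).
Proof.
move=> ijm si sj; apply: contrapT => nk.
have adjsE k : (i <= k <= j)%N -> G s (p k) <-> k = i \/ k = j.
  move=> ikj; split=> [sk|[->|->]] //; apply: contrapT => nij.
  by apply: nk; exists k => //; lia.
have adjpE k l : (k <= m)%N -> (l <= m)%N ->
    G (p k) (p l) <-> k = l.+1 \/ l = k.+1.
  move=> km lm; split=> [kl|[e|e]]; last 2 first.
  - by rewrite e; apply/adj_sym/adj_p; lia.
  - by rewrite e; apply: adj_p; lia.
  case: (ltngtP k l) => [lt|lt|eq].
  - by right; apply: ind_p kl; lia.
  - by left; apply: ind_p (adj_sym kl); lia.
  - by case: (adj_irrefl (g := G) (x := p k)); rewrite {2}eq.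
(* Index 0 is [s], and the other [j - i + 1] indices run through the path; the length exceeds 3
   because [i.+1 < j]. *)
pose c (t : 'I_(j - i).+2) := if val t is t'.+1 then p (i + t')%N else s.
apply: (chordalG (c := c)); first by lia.
split; first by lia.
- move=> [[|a] ha] [[|b] hb] //= e; apply: val_inj => //=.
  + by case: (p_neq _ (esym e)); lia.
  + by case: (p_neq _ e); lia.
  + by have := inj_p _ _ e; lia.
- move=> [[|a] ha] [[|b] hb]; rewrite cyclic_adj_val /c /=.
  + by split=> [|ss]; [lia|case: (adj_irrefl ss)].
  + by rewrite adjsE; lia.
  + split=> [|/(@adj_sym _ G)]; last by rewrite adjsE; lia.
    by move=> h; apply: adj_sym; rewrite adjsE; lia.
  + by rewrite adjpE; lia.
Qed.

(** Neighbours of [s] keep splitting the interval by [fan_gap] until [k] is an end. *)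
Lemma fan i j k : (i <= k <= j)%N -> (j <= m)%N -> G s (p i) -> G s (p j) ->
  G s (p k).
Proof.
have [n] := ubnP (j - i); elim: n i j => // n IHn i j jin ikj jm si sj.
have [->//|nki] := eqVneq k i; have [->//|nkj] := eqVneq k j.
have [|l ilj sl] := fan_gap (i := i) (j := j) _ si sj; first by lia.
case: (leqP k l) => kl; first by apply: (IHn i l) => //; lia.
by apply: (IHn l j) => //; lia.
Qed.

End Fan.

(* One uniform choice, so that equal classes get equal representatives. *)
Lemma choice_function (T : Type) : inhabited T ->
  exists r : set T -> T, forall P : set T, P !=set0 -> P (r P).
Proof.
move=> [x0]; exists (fun P => xget (x0 : {classic T}) P) => P [x Px].
exact: (xgetPex (x0 : {classic T}) (ex_intro P x Px)).
Qed.

(** * Construction of a clique tree from stars *)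

Section Existence.
Variables (V : Type) (G : graph V).
Hypotheses (conG : connected_graph G) (lfG : locally_finite G).
Hypothesis chordalG : chordal G.
Variable r : set (clique G) -> clique G.
Hypothesis rP : forall P, P !=set0 -> P (r P).
Implicit Types (S : set V) (K L M : clique G) (u v : V).

(** Not reflexive in general: a clique contained in [S] is on no side. *)
Definition same_side S K L := exists u v,
  [/\ sval K u /\ ~ S u, sval L v /\ ~ S v & linked G S u v].

Lemma same_side_common S K L u :
  sval K u -> sval L u -> ~ S u -> same_side S K L.
Proof. by move=> Ku Lu nSu; exists u, u; split=> //; exact: rt_refl. Qed.

Lemma same_side_sym S K L : same_side S K L -> same_side S L K.
Proof.
by move=> [u [v [Ku Lv uv]]]; exists v, u; split=> //; exact: linked_sym.
Qed.

Lemma same_side_trans S K L M :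
  same_side S K L -> same_side S L M -> same_side S K M.
Proof.
move=> [u [v [Ku [Lv nSv] uv]]] [v' [w [[Lv' nSv'] Mw v'w]]].
exists u, w; split=> //; apply: rt_trans uv (rt_trans _ _ _ _ _ _ v'w).
exact: clique_linked Lv Lv' nSv nSv'.
Qed.

Definition side S K := [set L | S `<=` sval L /\ same_side S K L].

Lemma side_eq S K L : same_side S K L -> side S K = side S L.
Proof.
move=> KL; apply/seteqP; split=> M [SM h]; split=> //.
  exact: same_side_trans (same_side_sym KL) h.
exact: same_side_trans KL h.
Qed.

Definition center S := r [set L | S `<=` sval L].

Definition ray S K L := K = center S /\ L = r (side S L).

(** Only rays whose ends meet exactly in [S] are kept, so each edge determines the star it comes
    from. *)
Definition star_adj K L := let S := sval K `&` sval L in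
  [/\ K <> L, S !=set0, ~ same_side S K L & ray S K L \/ ray S L K].

Lemma star_adj_sym K L : star_adj K L -> star_adj L K.
Proof.
move=> [KL S0 nside rays]; rewrite /star_adj setIC.
split=> //; [exact: nesym| |tauto].
by move=> LK; apply: nside; exact: same_side_sym.
Qed.

Lemma star_adj_irrefl K : ~ star_adj K K.
Proof. by case. Qed.

Definition star_tree := Graph star_adj_sym star_adj_irrefl.

(* Edges with a smaller intersection are discarded because they may join cliques
   lying in different components of G minus the intersection of K and L. *)
Lemma star_tree_cut K L : star_tree K L ->
  ~ reach (fun M N => remove_edge star_tree K L M N /\
             ~ (sval M `&` sval N `<` sval K `&` sval L)) K L.
Proof.
wlog : K L / ray (sval K `&` sval L) K L.
  move=> oriented KL; have [_ _ _ [|rayLK]] := KL.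
    by move=> o; exact: (oriented K L o KL).
  rewrite setIC in rayLK; move=> reachKL; apply: (oriented L K rayLK).
    exact: adj_sym.
  apply: reach_sym; last first.
    apply: reach_sub reachKL => M N [MN nlt]; rewrite [sval L `&` _]setIC.
    by split=> //; exact: remove_edgeC.
  move=> M N [MN nlt]; split; last by rewrite setIC.
  by apply: remove_edge_sym MN; exact: adj_sym.
set S := sval K `&` sval L.
move=> [Kcen Lr] [KL S0 nKL _] KreachL.
have sideL : same_side S L L.
  have [u Lu nKu] := clique_diff (nesym KL).
  by apply: (same_side_common (u := u)) => //; case.
suff : ~ same_side S L L by [].
apply: (reach_invariant (P := fun M => ~ same_side S L M) _ KreachL);
  last first.
  by move/same_side_sym.
(* An edge entering the side of [L] cannot share a vertex outside [S], so its intersection is [S]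
   and it is a ray of [S]. Either it is the removed edge, or it enters at the center [K], which is
   not on that side. *)
move=> M N [[MN nKLe nLKe] nlt] nLM LN; apply: nLM.
have [MNS|] := pselect (sval M `&` sval N `<=` S); last first.
  move/existsNP => [u /not_implyP[[Mu Nu] nSu]].
  exact: same_side_trans LN (same_side_common Nu Mu nSu).
have eS : sval M `&` sval N = S.
  apply: contrapT => neq; apply: nlt; rewrite properEneq; split=> //.
  exact/eqP.
have [_ _ _] := MN; rewrite /= eS => -[[Mcen Nr]|[Ncen _]].
  by case: nKLe; split; [rewrite Mcen Kcen|rewrite Nr Lr (side_eq LN)].
by case: nKL; apply: same_side_sym; rewrite Ncen -Kcen in LN.
Qed.

Lemma star_tree_acyclic n (c : 'I_n -> clique G) : ~ is_cycle star_tree c.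
Proof.
move=> cyc; have [n3 _ adjc] := cyc.
pose i0 := Ordinal (leq_trans (isT : (0 < 3)%N) n3).
pose S (i : 'I_n) := sval (c i) `&` sval (c (ordS i)).
(* With least cardinality at [i], no other edge of the cycle has a strictly smaller intersection, so
   the detour survives in [star_tree_cut]. *)
have [i _ i_min] := arg_minnP (fun i => fcard (S i)) (isT : xpredT i0).
have Ti : star_tree (c (ordS i)) (c i) by apply: adjc; right.
have finS : finite_set (sval (c i)).
  have [_ [v [_ cv]] _ _] := Ti.
  exact: (finite_complete lfG (@clique_complete _ _ (c i)) cv).
apply: star_tree_cut Ti _; apply: reach_sub (cycle_detour i cyc).
move=> M N [j ji [-> ->]]; have [e1 e2] := cycle_edge_inj cyc ji; split.
  by split=> //; apply: adjc; left.
rewrite [X in _ `<` X]setIC => lt; have := i_min j isT; apply/negP.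
rewrite -ltnNge; apply: fcard_proper => //.
by apply: sub_finite_set finS => u [].
Qed.

Lemma star_tree_connected S K L : S !=set0 -> S `<=` sval K -> S `<=` sval L ->
  reach (restrict star_tree [set M | S `<=` sval M]) K L.
Proof.
move=> [v Sv].
have [n] := ubnP (fcard (closed_nbhd G v) - fcard S).
elim: n S Sv K L => // n IHn S Sv K L lt_n SK SL.
have [->|KL] := pselect (K = L); first exact: rt_refl.
have sub_nbhd M : S `<=` sval M -> sval M `<=` closed_nbhd G v.
  by move=> SM; apply: complete_closed_nbhd (SM _ Sv); exact: clique_complete.
(* A clique containing [S] and contained in [S] would equal both [K] and [L]. *)
have not_sub M : S `<=` sval M -> exists2 u, sval M u & ~ S u.
  move=> SM; apply: contrapT => noU; apply: KL.
  have MS : sval M `<=` S.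
    by move=> u Mu; apply: contrapT => nSu; apply: noU; exists u.
  transitivity M; [apply/esym|]; apply: clique_eq; exact: subset_trans MS _.
(* The induction hypothesis applies to the intersection of [M] and [N], which is larger than [S] by
   [u]. *)
have meet M N u : S `<=` sval M -> S `<=` sval N ->
    sval M u -> sval N u -> ~ S u ->
    reach (restrict star_tree [set M | S `<=` sval M]) M N.
  move=> SM SN Mu Nu nSu.
  have SMN : S `<=` sval M `&` sval N.
    by move=> w Sw; split; [exact: SM|exact: SN].
  have ltS : (fcard S < fcard (sval M `&` sval N))%N.
    apply: fcard_proper.
      apply: sub_finite_set (finite_closed_nbhd lfG v) => w [Mw _].
      exact: sub_nbhd Mw.
    by rewrite properEneq; split=> //; apply/eqP => eS; apply: nSu; rewrite eS.
  have leN : (fcard (sval M `&` sval N) <= fcard (closed_nbhd G v))%N.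
    apply: fcard_sub; first exact: finite_closed_nbhd.
    by move=> w [Mw _]; exact: sub_nbhd Mw.
  have := IHn (sval M `&` sval N) (SMN _ Sv) M N.
  move=> /(_ _)/(_ (@subIsetl _ _ _))/(_ (@subIsetr _ _ _)) IH.
  apply: reach_sub (IH _); last by lia.
  move=> P Q [PQ SP SQ].
  by split=> //; [move: SP|move: SQ]; exact: subset_trans.
have same M N : S `<=` sval M -> S `<=` sval N -> same_side S M N ->
    reach (restrict star_tree [set M | S `<=` sval M]) M N.
  move=> SM SN [x [y [[Mx nSx] [Ny nSy] xy]]].
  have [m [p [[p0 pm adj_p] inj_p ind_p]]] := geodesic_exists xy.
  have nSp k : (k <= m)%N -> ~ S (p k).
    case: k => [|k] km; first by rewrite p0.
    by have [] := adj_p k km.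
  have Sp k s : (k <= m)%N -> S s -> G s (p k).
    move=> km Ss; apply: (@fan _ G p m s _ _ _ _ _ 0 m) => //.
    - by move=> i /adj_p[].
    - move=> i j ijm pij; apply: ind_p => //; split=> //; apply: nSp; lia.
    - by move=> i /nSp nSpi ei; apply: nSpi; rewrite ei.
    - rewrite p0; apply: (clique_complete (K := M)) => //; first exact: SM.
      by move=> e; apply: nSx; rewrite -e.
    - rewrite pm; apply: (clique_complete (K := N)) => //; first exact: SN.
      by move=> e; apply: nSy; rewrite -e.
  have Scompl : complete_set G S.
    by move=> s t Ss St; apply: (clique_complete (K := M)); exact: SM.
  (* Together with [S], consecutive geodesic vertices form a complete set by [Sp]; the cliques
     containing these sets meet successively outside [S], so [meet] joins them. *)
  have chain k : (k <= m)%N -> forall P, S `<=` sval P -> sval P (p k) ->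
      reach (restrict star_tree [set M | S `<=` sval M]) M P.
    elim: k => [|k IHk] km P SP Pp.
      by apply: (meet _ _ x) => //; rewrite -p0.
    have Gpk : G (p k) (p k.+1) by have [] := adj_p k km.
    have [||Q SQ] := @complete_sub_clique _ G lfG (S `|` [set p k; p k.+1]) v.
    - have Spk := Sp k ^~ (ltnW km); have SpSk := Sp k.+1 ^~ km.
      move=> s t [Ss|[->|->]] [St|[->|->]] //; by
        [exact: Scompl|move=> _; auto using (@adj_sym _ G)].
    - by left.
    have Qp : sval Q (p k) by apply: SQ; right; left.
    have QpS : sval Q (p k.+1) by apply: SQ; right; right.
    have {}SQ : S `<=` sval Q by move=> w Sw; apply: SQ; left.
    apply: rt_trans (IHk (ltnW km) Q SQ Qp) _.
    by apply: (meet _ _ (p k.+1)) => //; exact: nSp.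
  by apply: (chain m) => //; rewrite pm.
have Scen : S `<=` sval (center S).
  by apply: (@rP [set M | S `<=` sval M]); exists K.
(* Within its class [M] reaches the representative, which a ray joins to the center; being on
   different sides, these two meet exactly in [S]. *)
have to_center M : S `<=` sval M ->
    reach (restrict star_tree [set M | S `<=` sval M]) M (center S).
  move=> SM; have [MC|nMC] := pselect (same_side S M (center S)).
    exact: same.
  have [SN MN] : side S M (r (side S M)).
    apply: rP; exists M; split=> //; have [u Mu nSu] := not_sub M SM.
    exact: (same_side_common Mu Mu nSu).
  set N := r (side S M) in SN MN.
  apply: rt_trans (same _ _ SM SN MN) _; apply: rt_step; split=> //.
  apply: adj_sym.
  have nCN : ~ same_side S (center S) N.
    move=> CN; apply: nMC; apply: same_side_trans MN (same_side_sym CN).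
  have eS : sval (center S) `&` sval N = S.
    apply/seteqP; split=> [u [Cu Nu]|u Su]; last first.
      by split; [exact: Scen|exact: SN].
    by apply: contrapT => nSu; apply: nCN; exact: same_side_common Cu Nu nSu.
  rewrite /= /star_adj eS; split=> //.
  - move=> eCN; apply: nMC; rewrite eCN; exact: MN.
  - by exists v.
  - by left; split=> //; rewrite /N -(side_eq MN).
apply: rt_trans (to_center K SK) _; apply: reach_sym (to_center L SL).
by apply: restrict_sym; exact: adj_sym.
Qed.

Lemma star_tree_clique_tree : is_clique_tree star_tree.
Proof.
have reach_vertex v K L : sval K v -> sval L v ->
    reach (restrict star_tree [set M | sval M v]) K L.
  move=> Kv Lv; have v0 : [set v] !=set0 by exists v.
  have vK : [set v] `<=` sval K by move=> _ ->.
  have vL : [set v] `<=` sval L by move=> _ ->.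
  apply: reach_sub (star_tree_connected v0 vK vL) => M N [MN vM vN].
  by split=> //; [exact: vM|exact: vN].
have [[v0] conn] := conG.
have treeT : is_tree star_tree.
  split; last exact: star_tree_acyclic.
  split; first by have [K _] := vertex_in_clique lfG v0; constructor.
  move=> K L.
  (* An empty clique would be contained in, hence equal to, a clique at [v0]. *)
  have nonempty M : exists u, sval M u.
    apply: contrapT => M0; have [N Nv0] := vertex_in_clique lfG v0.
    suff eMN : M = N by apply: M0; exists v0; rewrite eMN.
    by apply: clique_eq => u Mu; case: M0; exists u.
  have [u Ku] := nonempty K; have [v Lv] := nonempty L.
  have reachT x M N : sval M x -> sval N x -> reach star_tree M N.
    by move=> Mx Nx; apply: reach_sub (reach_vertex x M N Mx Nx) => ? ? [].
  (* Propagated along a walk of [G] from [u] to [v]: each edge lies in a clique that passes between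
     the cliques at its two ends. *)
  pose P x := forall M, sval M x -> reach star_tree K M.
  have : P v; last exact.
  apply: (reach_invariant (P := P) _ (conn u v)) => [x y xy Px M My|M].
    have [Q [Qx Qy]] := edge_in_clique lfG xy.
    exact: rt_trans (Px Q Qx) (reachT y Q M Qy My).
  exact: reachT.
split=> // [K L [KL S0 _ _]|v]; first by split.
apply/(induced_treeP _ treeT); split; last by move=> K L; exact: reach_vertex.
exact: vertex_in_clique.
Qed.

End Existence.

Lemma clique_tree_exists (V : Type) (G : graph V) :
  connected_graph G -> locally_finite G -> chordal G ->
  exists T : graph (clique G), is_clique_tree T.
Proof.
move=> conG lfG chordalG; have [[v] _] := conG.
have [K _] := vertex_in_clique lfG v.
have [r rP] := choice_function (inhabits K).
by exists (star_tree r); exact: star_tree_clique_tree.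
Qed.

Lemma graph_eq (X : Type) (G H : graph X) :
  (forall x y, G x y <-> H x y) -> G = H.
Proof.
case: G H => [adjG symG irrG] [adjH symH irrH] /= GH.
have eq : adjG = adjH by apply/funext => x; apply/funext => y; exact/propext.
by subst adjH; congr Graph; exact: Prop_irrelevance.
Qed.

Theorem theorem3p12 (V : Type) (G : graph V)
    (G_connected : connected_graph G) (G_locally_finite : locally_finite G)
    (G_chordal : chordal G) :
  (forall T : graph (clique G), is_clique_tree T ->
     edge_intersections T = [set W | minimal_separator G W]) /\
  clique_tree_union G = reduced_clique_graph G.
Proof.
split=> [T|]; first exact: edge_intersections_clique_tree.
apply: graph_eq => K L; split=> [[T treeT TKL]|].
  exact: (clique_tree_edge_reduced G_locally_finite treeT TKL).
move=> [[KL _] [u [v [Ku Lv sep]]]].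
have [T treeT] := clique_tree_exists G_connected G_locally_finite G_chordal.
have [A [B [TAB eqI KA BL]]] :=
  minimal_separator_clique_tree_edge G_locally_finite treeT sep Ku Lv.
exact: clique_tree_exchange treeT TAB KL KA BL eqI.
Qed.
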